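(* Considering the Halley's method associated to the function $f(t)=t^2-x$ and a starting point $r$, the corresponding sequence $\{h_n\}_{n\ge 0}$ can be expressed using the Chebyshev polynomials $T_k$ as follows: $$(\forall n\ge 0),\qquad h_n=r\prod_{i=1}^{n}\frac{2T_{3^{i-1}}\left(\frac{x+r^2}{x-r^2}\right)+1}{2T_{3^{i-1}}\left(\frac{x+r^2}{x-r^2}\right)-1}.$$
   Context: Here $x$ is a positive real number. The sequence of Halley's method associated to $f(t)=t^2-x$ with starting point $r$ is defined by $h_0=r$ and $h_{n+1}=h_n\,\frac{h_n^2+3x}{3h_n^2+x}$ for all $n\ge 0$. $T_k$ denotes the Chebyshev polynomial of the first kind: $T_0(X)=1$, $T_1(X)=X$, $T_{k+1}(X)=2XT_k(X)-T_{k-1}(X)$. An empty product equals $1$. *)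

(* Defs.v *)
From mathcomp Require Import all_boot all_order all_algebra.

Set Implicit Arguments.
Unset Strict Implicit.
Unset Printing Implicit Defensive.

Import Order.TTheory GRing.Theory Num.Theory.
Local Open Scope ring_scope.

Fixpoint chebyshevT (R : comNzRingType) (k : nat) {struct k} : {poly R} :=
  match k with
  | 0 => 1
  | k1.+1 =>
    match k1 with
    | 0 => 'X
    | k2.+1 => 2%:R *: 'X * chebyshevT R k1 - chebyshevT R k2
    end
  end.

(* For f(t) = t^2 - x the general Halley step h - 2 f f' / (2 f'^2 - f f'')
   simplifies to h (h^2 + 3x) / (3h^2 + x). Over the reals
   with x > 0 the denominator never vanishes. *)
Fixpoint halley (R : fieldType) (x r : R) (n : nat) : R :=
  match n with
  | 0 => r
  | m.+1 =>
    let h := halley x r m in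
    h * ((h ^+ 2 + 3%:R * x) / (3%:R * h ^+ 2 + x))
  end.

(* Main.v *)
Require Import Defs.
From mathcomp Require Import all_boot all_order all_algebra.
From mathcomp Require Import reals.
From mathcomp Require Import ring lra.

Set Implicit Arguments.
Unset Strict Implicit.
Unset Printing Implicit Defensive.

Import Order.TTheory GRing.Theory Num.Theory.
Local Open Scope ring_scope.

(** Put [s] for the square root of [x].  The Cayley transform
    [h |-> (s + h) / (s - h)] sends the two zeros [s], [- s] of [t ^+ 2 - x] to
    infinity and [0], and conjugates the Halley step to cubing: if [h'] is the
    successor of [h], then [s + h'] and [s - h'] are [(s + h) ^+ 3] and
    [(s - h) ^+ 3] over the same denominator.  With [u := (s + r) / (s - r)],
    the transform of the [n]-th iterate is therefore [u ^+ (3 ^ n)]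
    ([cayley_halley]).

    Chebyshev polynomials enter through the identity
    [T_k ((u + u^-1) / 2) = (u ^+ k + u ^- k) / 2] ([chebyshevT_joukowsky]).
    The half-sum of [(s + h) / (s - h)] and its inverse is
    [(x + h ^+ 2) / (x - h ^+ 2)] ([joukowsky_cayley]), so with [k = 3 ^ n] the
    identity says that [T_(3 ^ n)] sends [(x + r ^+ 2) / (x - r ^+ 2)] to
    [c := (x + h ^+ 2) / (x - h ^+ 2)], where [h] is the [n]-th iterate
    ([chebyshevT_halley]).  Finally
    [(2 c + 1) / (2 c - 1) = (h ^+ 2 + 3 x) / (3 h ^+ 2 + x)] is exactly the factor
    by which the Halley step multiplies [h], and the product telescopes. *)

(** Both sides satisfy the same two-term recurrence, because
    [(u + u^-1) (u ^+ k + u ^- k)] is the sum of the expressions for [k + 1] and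
    [k - 1]. *)
Lemma chebyshevT_joukowsky (F : fieldType) (u : F) (k : nat) :
    2%:R != 0 :> F -> u != 0 ->
  (chebyshevT F k).[(u + u^-1) / 2%:R] = (u ^+ k + u ^- k) / 2%:R.
Proof.
move=> two_neq0 u_neq0.
(* The recurrence has order two, so two consecutive indices are carried. *)
suff [] : (chebyshevT F k).[(u + u^-1) / 2%:R] = (u ^+ k + u ^- k) / 2%:R /\
  (chebyshevT F k.+1).[(u + u^-1) / 2%:R] = (u ^+ k.+1 + u ^- k.+1) / 2%:R by [].
elim: k => [|k [IHk IHk1]].
  split; last by rewrite /= hornerX !expr1.
  by rewrite /= hornerC expr0 invr1 divff.
split=> //.
have -> : chebyshevT F k.+2 =
  2%:R *: 'X * chebyshevT F k.+1 - chebyshevT F k by [].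
rewrite hornerD hornerN hornerM hornerZ hornerX IHk IHk1 !exprS.
have uk_neq0 : u ^+ k != 0 by rewrite expf_neq0.
by field; rewrite two_neq0 uk_neq0.
Qed.

Lemma joukowsky_cayley (F : fieldType) (s h : F) :
    2%:R != 0 :> F -> s + h != 0 -> s - h != 0 ->
  ((s + h) / (s - h) + ((s + h) / (s - h))^-1) / 2%:R =
  (s ^+ 2 + h ^+ 2) / (s ^+ 2 - h ^+ 2).
Proof.
move=> two_neq0 sDh_neq0 sBh_neq0.
have -> : s ^+ 2 - h ^+ 2 = (s - h) * (s + h) by ring.
by field; rewrite two_neq0 sDh_neq0 sBh_neq0.
Qed.

Lemma halley_denom_gt0 (R : realFieldType) (x h : R) :
  0 < x -> 0 < 3%:R * h ^+ 2 + x.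
Proof. by move=> x_gt0; have := sqr_ge0 h; lra. Qed.

(** The successor [h'] of [h] satisfies
    [s + h' = (s + h) ^+ 3 / (3 h ^+ 2 + s ^+ 2)], and likewise with [h] replaced
    by [- h]; the common denominator cancels in the quotient.  The non-vanishing
    statements belong to the same induction: they say that no iterate hits a
    zero of [t ^+ 2 - s ^+ 2]. *)
Lemma cayley_halley (R : realFieldType) (s r : R) (n : nat) :
    s != 0 -> s + r != 0 -> s - r != 0 ->
  let h := halley (s ^+ 2) r n in
  [/\ s + h != 0, s - h != 0 &
      (s + h) / (s - h) = ((s + r) / (s - r)) ^+ (3 ^ n)].
Proof.
move=> s_neq0 sDr_neq0 sBr_neq0 /=.
elim: n => [|n [sDh_neq0 sBh_neq0 IHn]]; first by rewrite expn0 expr1.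
rewrite expnSr exprM -IHn /=.
move: (halley (s ^+ 2) r n) sDh_neq0 sBh_neq0 => h sDh_neq0 sBh_neq0.
have d_neq0 : 3%:R * h ^+ 2 + s ^+ 2 != 0.
  by rewrite lt0r_neq0 // halley_denom_gt0 // exprn_even_gt0.
set h' := h * _.
have sDh' : s + h' = (s + h) ^+ 3 / (3%:R * h ^+ 2 + s ^+ 2).
  by rewrite /h'; field.
have sBh' : s - h' = (s - h) ^+ 3 / (3%:R * h ^+ 2 + s ^+ 2).
  by rewrite /h'; field.
rewrite sDh' sBh'; split.
- by rewrite mulf_neq0 ?invr_eq0 ?expf_neq0.
- by rewrite mulf_neq0 ?invr_eq0 ?expf_neq0.
- by field; rewrite d_neq0 sBh_neq0.
Qed.

Lemma chebyshevT_halley (R : rcfType) (x r : R) (n : nat) :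
    0 < x -> r ^+ 2 != x ->
  let h := halley x r n in
  h ^+ 2 != x /\
  (chebyshevT R (3 ^ n)).[(x + r ^+ 2) / (x - r ^+ 2)] =
    (x + h ^+ 2) / (x - h ^+ 2).
Proof.
move=> x_gt0; rewrite -(sqr_sqrtr (ltW x_gt0)).
have : Num.sqrt x != 0 by rewrite sqrtr_eq0 -ltNge.
move: (Num.sqrt x) => s s_neq0.
have sqr_neq (h : R) : (h ^+ 2 != s ^+ 2) = (s - h != 0) && (s + h != 0).
  by rewrite eq_sym -subr_eq0 subr_sqr mulf_eq0 negb_or.
rewrite sqr_neq => /andP[sBr_neq0 sDr_neq0] /=.
have [sDh_neq0 sBh_neq0 cayley_h] :=
  cayley_halley n s_neq0 sDr_neq0 sBr_neq0.
split; first by rewrite sqr_neq sBh_neq0.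
have two_neq0 : 2%:R != 0 :> R by rewrite pnatr_eq0.
rewrite -!joukowsky_cayley // chebyshevT_joukowsky //.
  by rewrite -cayley_h.
by rewrite mulf_neq0 ?invr_eq0.
Qed.

Theorem theorem5 (R : realType) (x r : R) (hx : 0 < x) (hr : r ^+ 2 != x)
    (n : nat) :
  halley x r n =
    r * \prod_(1 <= i < n.+1)
      ((2%:R * (chebyshevT R (3 ^ i.-1)).[(x + r ^+ 2) / (x - r ^+ 2)] + 1) /
       (2%:R * (chebyshevT R (3 ^ i.-1)).[(x + r ^+ 2) / (x - r ^+ 2)] - 1)).
Proof.
elim: n => [|n IHn]; first by rewrite big_geq // mulr1.
rewrite big_nat_recr // mulrA -IHn -pred_Sn [LHS]/=.
have [h2_neq ->] := chebyshevT_halley n hx hr.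
move: (halley x r n) h2_neq => h h2_neq; congr (_ * _).
have xBh2_neq0 : x - h ^+ 2 != 0 by rewrite subr_eq0 eq_sym.
have d_gt0 := halley_denom_gt0 h hx.
(* With [c = (x + h ^+ 2) / (x - h ^+ 2)], the numerators of [2 c + 1] and
   [2 c - 1] are [h ^+ 2 + 3 x] and [3 h ^+ 2 + x]. *)
have -> : 2%:R * ((x + h ^+ 2) / (x - h ^+ 2)) + 1 =
  (h ^+ 2 + 3%:R * x) / (x - h ^+ 2) by field.
have -> : 2%:R * ((x + h ^+ 2) / (x - h ^+ 2)) - 1 =
  (3%:R * h ^+ 2 + x) / (x - h ^+ 2) by field.
by field; rewrite xBh2_neq0 lt0r_neq0.
Qed.
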